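(* Let $\nu\in\mathbb{N}=\{1,2,\dots\}$, let $V_\nu(x)=-\nu(\nu+1)(\cosh x)^{-2}$ on $\mathbb{R}$ (a function in the Schwartz class), let $H_\nu=-d^2/dx^2+V_\nu$ on $L^2(\mathbb{R})$, and let $p_t(x,y)=e^{-tH_\nu}(x,y)$ be its heat kernel. Then the estimates $$|p_t(x,y)|\le C\,t^{-1/2}e^{-c|x-y|^2/t}\qquad\text{and}\qquad |\partial_x p_t(x,y)|\le C\,t^{-1}e^{-c|x-y|^2/t}$$ fail as $t\to\infty$: for each of these two estimates, there are no constants $C,c,T>0$ such that it holds for all $x,y\in\mathbb{R}$ and all $t\ge T$.
   Context: $H_\nu$ is the selfadjoint Schr\''odinger operator on $L^2(\mathbb{R})$ with bounded potential $V_\nu$, and $e^{-tH_\nu}(x,y)$ denotes the integral kernel of the semigroup operator $e^{-tH_\nu}$, $t>0$. *)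

(* Defs.v *)
From mathcomp Require Import all_boot all_order all_algebra.
From mathcomp Require Import all_classical all_reals all_analysis.
From mathcomp Require Import complex.

Set Implicit Arguments.
Unset Strict Implicit.
Unset Printing Implicit Defensive.

Import Order.TTheory GRing.Theory Num.Theory.
Import numFieldTopology.Exports numFieldNormedType.Exports.

Local Open Scope classical_set_scope.
Local Open Scope ring_scope.
Local Open Scope complex_scope.

(** ** Complex-valued functions of a real variable

    R[i] carries no topology or measurable structure in the library, so
    measurability, integrals, continuity and derivatives are taken on real and
    imaginary parts. *)

Definition repart (R : realType) (T : Type) (f : T -> R[i]) : T -> R :=
  fun x => complex.Re (f x).

Definition impart (R : realType) (T : Type) (f : T -> R[i]) : T -> R :=
  fun x => complex.Im (f x).

(* The norm `|z| of the library is an element of R[i] with null imaginary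
   part. *)
Definition cabs (R : realType) (z : R[i]) : R := complex.Re `|z|.

Definition ccontinuous (R : realType) (T : topologicalType) (f : T -> R[i]) :=
  continuous (repart f) /\ continuous (impart f).

Definition cderivable (R : realType) (f : R -> R[i]) (x : R) :=
  derivable (repart f) x 1 /\ derivable (impart f) x 1.

Definition cderive (R : realType) (f : R -> R[i]) (x : R) : R[i] :=
  derive1 (repart f) x +i* derive1 (impart f) x.

Definition cintegrable (R : realType) (f : R -> R[i]) :=
  (@lebesgue_measure R).-integrable setT (EFin \o repart f) /\
  (@lebesgue_measure R).-integrable setT (EFin \o impart f).

Definition cintegral (R : realType) (f : R -> R[i]) : R[i] :=
  (\int[@lebesgue_measure R]_x repart f x) +i*
  (\int[@lebesgue_measure R]_x impart f x).

(** ** The complex space L^2(R)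

    Elements of L^2(R) are handled through representatives, and equality in
    L^2(R) is [aeeq]. *)

Definition aeeq (R : realType) (f g : R -> R[i]) :=
  {ae @lebesgue_measure R, forall x, f x = g x}.

Definition L2norm (R : realType) (f : R -> R[i]) : \bar R :=
  Lnorm (@lebesgue_measure R) 2%:E (fun x => (cabs (f x))%:E).

Definition inL2 (R : realType) (f : R -> R[i]) :=
  [/\ measurable_fun setT (repart f),
      measurable_fun setT (impart f) &
      (L2norm f < +oo)%E].

(** ** The Schroedinger operator H = - d^2/dx^2 + V *)

Definition test_function (R : realType) (phi : R -> R) :=
  (forall n x, derivable (derive1n n phi) x 1) /\
  (exists r, forall x, r < `|x| -> phi x = 0).

Definition weak_derivative (R : realType) (f g : R -> R[i]) :=
  forall phi, test_function phi ->
    cintegral (fun x => f x * (derive1 phi x)%:C) =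
    - cintegral (fun x => g x * (phi x)%:C).

(* [schrodinger V f g] is the graph of H: f is in the domain, the Sobolev space
   H^2(R), and H f = g. For bounded V this operator is selfadjoint. *)
Definition schrodinger (R : realType) (V : R -> R) (f g : R -> R[i]) :=
  [/\ inL2 f, inL2 g &
      exists f1 f2 : R -> R[i],
        [/\ inL2 f1, inL2 f2, weak_derivative f f1, weak_derivative f1 f2 &
            aeeq g (fun x => - f2 x + (V x)%:C * f x)]].

(** ** Operator semigroups on L^2(R) *)

Record C0_semigroup (R : realType)
    (S : R -> (R -> R[i]) -> (R -> R[i])) : Prop := {
  sg_L2 : forall (t : R) f, 0 <= t -> inL2 f -> inL2 (S t f);
  sg_aeeq : forall (t : R) f g, 0 <= t -> inL2 f -> inL2 g ->
    aeeq f g -> aeeq (S t f) (S t g);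
  sg_linear : forall (t : R) (a : R[i]) f g, 0 <= t -> inL2 f -> inL2 g ->
    aeeq (S t (fun x => a * f x + g x)) (fun x => a * S t f x + S t g x);
  sg_bounded : forall t : R, 0 <= t -> exists M : R, forall f, inL2 f ->
    (L2norm (S t f) <= M%:E * L2norm f)%E;
  sg_id : forall f, inL2 f -> aeeq (S 0 f) f;
  sg_add : forall (s t : R) f, 0 <= s -> 0 <= t -> inL2 f ->
    aeeq (S (s + t) f) (S s (S t f));
  sg_cont : forall f, inL2 f ->
    L2norm (fun x => S t f x - f x) @[t --> 0^'+] --> (0%R%:E : \bar R)
}.

(* Graph of the infinitesimal generator of S. *)
Definition sg_generator (R : realType) (S : R -> (R -> R[i]) -> (R -> R[i]))
    (f g : R -> R[i]) :=
  [/\ inL2 f, inL2 g &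
      L2norm (fun x => (t^-1)%:C * (S t f x - f x) - g x) @[t --> 0^'+]
        --> (0%R%:E : \bar R)].

(* [schrodinger_semigroup V S] means S t = e^{-tH} for t >= 0: S is the strongly
   continuous semigroup whose generator, domain included, is -H. This determines
   S t as an operator on L^2(R). *)
Definition schrodinger_semigroup (R : realType) (V : R -> R)
    (S : R -> (R -> R[i]) -> (R -> R[i])) :=
  C0_semigroup S /\
  (forall f g, sg_generator S f g <-> schrodinger V f (fun x => - g x)).

(* [heat_kernel V p] means p t x y = e^{-tH}(x,y) for t > 0. An integral kernel
   is only determined almost everywhere; continuity in (x,y) selects the
   representative for which pointwise bounds make sense. *)
Definition heat_kernel (R : realType) (V : R -> R) (p : R -> R -> R -> R[i]) :=
  exists2 S : R -> (R -> R[i]) -> (R -> R[i]),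
    schrodinger_semigroup V S &
    forall t : R, 0 < t ->
      ccontinuous (fun z : R * R => p t z.1 z.2) /\
      (forall f, inL2 f ->
         {ae @lebesgue_measure R, forall x,
            cintegrable (fun y => p t x y * f y) /\
            S t f x = cintegral (fun y => p t x y * f y)}).

(** ** The potential and the two estimates *)

Definition coshR (R : realType) (x : R) : R := (expR x + expR (- x)) / 2.

Definition potential (R : realType) (nu : nat) (x : R) : R :=
  - (nu * nu.+1)%:R * (coshR x) ^- 2.

Definition kernel_bound (R : realType) (p : R -> R -> R -> R[i]) (C c T : R) :=
  forall t x y, T <= t ->
    cabs (p t x y) <= C * t `^ (- 2^-1) * expR (- c * `|x - y| ^+ 2 / t).

(* The library's derivative is a total function with an unspecified value where
   the derivative does not exist, whence the conjunct [cderivable]. *)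
Definition kernel_dx_bound (R : realType) (p : R -> R -> R -> R[i])
    (C c T : R) :=
  forall t x y, T <= t ->
    cderivable (fun x' => p t x' y) x /\
    cabs (cderive (fun x' => p t x' y) x) <=
      C * t^-1 * expR (- c * `|x - y| ^+ 2 / t).

(* Main.v *)
Require Import Defs.
From mathcomp Require Import all_boot all_order all_algebra.
From mathcomp Require Import all_classical all_reals all_analysis.
From mathcomp Require Import measurable_realfun complex.
From mathcomp Require Import ring lra.

Set Implicit Arguments.
Unset Strict Implicit.
Unset Printing Implicit Defensive.

Import Order.TTheory GRing.Theory Num.Theory.
Import numFieldTopology.Exports numFieldNormedType.Exports.

Local Open Scope classical_set_scope.
Local Open Scope ring_scope.
Local Open Scope complex_scope.

(** The function [psi = cosh^(-nu)] is a bound state: [H psi = - nu^2 psi], so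
    [e^(-tH) psi = e^(nu^2 t) psi] grows exponentially. On the other hand, either
    estimate, even with the Gaussian factor dropped, controls [e^(-tH) psi] for
    large [t] uniformly: the first one bounds its values by a constant times the
    [L^1] norm of [psi], and the second one bounds its Lipschitz constant in the
    same way, which is impossible since [psi] is not constant.

    The identity [S t psi = e^(lam t) psi] for an eigenvector [psi] of the
    generator is obtained by cutting [[0, t]] into [n] steps of length [h]: each
    step costs [|S h psi - e^(lam h) psi| = o(h)], and the costs add up to [o(1)]
    because [|S s|] is bounded for small [s]. The latter fact is the uniform
    boundedness principle, proved here by a gliding hump argument; it rests on
    the completeness of [L^2]. *)

(** * The space L^2 *)

Section cabs_theory.
Context {R : realType}.
Implicit Types z w : R[i].

Lemma complexReD z w : complex.Re (z + w) = complex.Re z + complex.Re w.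
Proof. by case: z; case: w. Qed.

Lemma cabsE z : cabs z = Num.sqrt (complex.Re z ^+ 2 + complex.Im z ^+ 2).
Proof. by rewrite /cabs normc_def. Qed.

Lemma cabs_normc z : cabs z = ComplexField.Normc.normc z.
Proof. by case: z. Qed.

Lemma cabs_ge0 z : 0 <= cabs z.
Proof. by rewrite cabsE sqrtr_ge0. Qed.

Lemma cabs0 : cabs (0 : R[i]) = 0.
Proof. by rewrite cabs_normc ComplexField.Normc.normc0. Qed.

Lemma cabsM z w : cabs (z * w) = cabs z * cabs w.
Proof. by rewrite !cabs_normc ComplexField.Normc.normcM. Qed.

Lemma cabsN z : cabs (- z) = cabs z.
Proof. by rewrite /cabs normrN. Qed.

Lemma cabs_eq0 z : cabs z = 0 -> z = 0.
Proof. by rewrite cabs_normc => /ComplexField.Normc.eq0_normc. Qed.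

Lemma le_cabsD z w : cabs (z + w) <= cabs z + cabs w.
Proof. by have := ler_normD z w; rewrite lecE complexReD => /andP[]. Qed.

Lemma cabs_real (r : R) : cabs r%:C = `|r|.
Proof. by rewrite cabsE /= expr0n addr0 sqrtr_sqr. Qed.

Lemma sqr_cabs z : cabs z ^+ 2 = complex.Re z ^+ 2 + complex.Im z ^+ 2.
Proof. by rewrite cabsE sqr_sqrtr// addr_ge0// sqr_ge0. Qed.

Lemma ler_Re_cabs z : `|complex.Re z| <= cabs z.
Proof. by rewrite cabsE -sqrtr_sqr ler_wsqrtr// lerDl sqr_ge0. Qed.

Lemma ler_Im_cabs z : `|complex.Im z| <= cabs z.
Proof. by rewrite cabsE -sqrtr_sqr ler_wsqrtr// lerDr sqr_ge0. Qed.

Lemma complexImD z w : complex.Im (z + w) = complex.Im z + complex.Im w.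
Proof. by case: z; case: w. Qed.

Lemma complexReM z w : complex.Re (z * w) =
  complex.Re z * complex.Re w - complex.Im z * complex.Im w.
Proof. by case: z; case: w. Qed.

Lemma complexImM z w : complex.Im (z * w) =
  complex.Re z * complex.Im w + complex.Im z * complex.Re w.
Proof. by case: z; case: w. Qed.

End cabs_theory.

(** * Measurability of complex-valued functions *)

Definition cmeas (R : realType) (f : R -> R[i]) :=
  measurable_fun setT (repart f) /\ measurable_fun setT (impart f).

Section cmeas_theory.
Context {R : realType}.
Implicit Types f g : R -> R[i].

Lemma inL2P f : inL2 f <-> cmeas f /\ (L2norm f < +oo)%E.
Proof. by split=> [[]|[[]]]. Qed.

Lemma inL2_meas f : inL2 f -> cmeas f.
Proof. by case. Qed.

Lemma cmeasD f g : cmeas f -> cmeas g -> cmeas (fun x => f x + g x).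
Proof.
move=> [f1 f2] [g1 g2]; split.
  have -> : repart (fun x => f x + g x) = repart f \+ repart g.
    by apply/funext => x; rewrite /repart complexReD.
  exact: measurable_funD.
have -> : impart (fun x => f x + g x) = impart f \+ impart g.
  by apply/funext => x; rewrite /impart complexImD.
exact: measurable_funD.
Qed.

Lemma cmeasZ (a : R[i]) f : cmeas f -> cmeas (fun x => a * f x).
Proof.
move=> [f1 f2]; split.
  have -> : repart (fun x => a * f x) =
      (fun x => complex.Re a * repart f x - complex.Im a * impart f x).
    by apply/funext => x; rewrite /repart complexReM.
  by apply: measurable_funB; apply: measurable_funM.
have -> : impart (fun x => a * f x) =
    (fun x => complex.Re a * impart f x + complex.Im a * repart f x).
  by apply/funext => x; rewrite /impart complexImM.
by apply: measurable_funD; apply: measurable_funM.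
Qed.

Lemma measurable_cabs f : cmeas f -> measurable_fun setT (fun x => cabs (f x)).
Proof.
move=> [f1 f2].
under eq_fun do rewrite cabsE -powR12_sqrt ?addr_ge0 ?sqr_ge0//.
apply: (measurableT_comp (measurable_powR _)).
by apply: measurable_funD; apply: measurable_funX.
Qed.

Lemma measurable_sqr_cabs f : cmeas f ->
  measurable_fun setT (fun x => (cabs (f x) ^+ 2)%:E).
Proof.
move=> mf; apply: (measurableT_comp (@EFin_measurable R setT)).
by apply: measurable_funX; exact: measurable_cabs.
Qed.

End cmeas_theory.

Section almost_everywhere.
Context {R : realType}.
Notation mu := (@lebesgue_measure R).

Lemma ae_imp (P Q : R -> Prop) : (forall x, P x -> Q x) ->
  {ae mu, forall x, P x} -> {ae mu, forall x, Q x}.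
Proof. by move=> PQ; apply: (@filterS _ _ (ae_filter_ringOfSetsType _)). Qed.

Lemma ae_and (P Q : R -> Prop) : {ae mu, forall x, P x} ->
  {ae mu, forall x, Q x} -> {ae mu, forall x, P x /\ Q x}.
Proof. by apply: (@filterI _ _ (ae_filter_ringOfSetsType _)). Qed.

End almost_everywhere.

(** * The seminorm of L^2 on representatives *)

Section L2norm_theory.
Context {R : realType}.
Notation mu := (@lebesgue_measure R).
Implicit Types f g : R -> R[i].

Lemma L2norm_ge0 f : (0 <= L2norm f)%E.
Proof. exact: Lnorm_ge0. Qed.

Lemma L2normE f :
  L2norm f = ((\int[mu]_x ((cabs (f x)) ^+ 2)%:E) `^ 2^-1)%E.
Proof.
rewrite /L2norm unlock; congr (_ `^ _)%E; apply: eq_integral => x _.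
by rewrite /= ger0_norm ?cabs_ge0// powR_mulrn ?cabs_ge0.
Qed.

Lemma sqr_L2norm f :
  (L2norm f * L2norm f = \int[mu]_x ((cabs (f x)) ^+ 2)%:E)%E.
Proof.
rewrite L2normE -poweRD.
  have -> : (2^-1 + 2^-1 : R) = 1 by field.
  rewrite poweRe1//.
  by apply: integral_ge0 => x _; rewrite lee_fin sqr_ge0.
by rewrite /poweRD_def gt_eqF.
Qed.

Lemma le_L2norm f g : cmeas f -> cmeas g ->
  (forall x, cabs (f x) <= cabs (g x)) -> (L2norm f <= L2norm g)%E.
Proof.
move=> mf mg fg; rewrite !L2normE gt0_ler_poweR ?invr_ge0//.
- by rewrite in_itv/= leey andbT integral_ge0// => x _; rewrite lee_fin sqr_ge0.
- by rewrite in_itv/= leey andbT integral_ge0// => x _; rewrite lee_fin sqr_ge0.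
- apply: ge0_le_integral => //.
  + by move=> x _; rewrite lee_fin sqr_ge0.
  + exact: measurable_sqr_cabs.
  + exact: measurable_sqr_cabs.
  + by move=> x _; rewrite lee_fin lerXn2r ?nnegrE ?cabs_ge0.
Qed.

Lemma L2normD f g : cmeas f -> cmeas g ->
  (L2norm (fun x => (f x + g x)%R) <= L2norm f + L2norm g)%E.
Proof.
move=> mf mg.
have h := @minkowski_EFin _ _ _ mu (@cabs R \o f) (@cabs R \o g) 2
  (measurable_cabs mf) (measurable_cabs mg) (ler1n _ 2).
(* [F] turns the real function [|f| + |g|] into a complex-valued one, so that monotonicity of
   [L2norm] reduces the claim to Minkowski's inequality for the moduli. *)
apply: le_trans h; pose F x := (cabs (f x) + cabs (g x))%:C.
have FE x : cabs (F x) = cabs (f x) + cabs (g x).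
  by rewrite cabs_real ger0_norm// addr_ge0// cabs_ge0.
have -> : 'N[mu]_2%:E[EFin \o ((@cabs R \o f) \+ (@cabs R \o g))%R]%E = L2norm F.
  by apply: eq_Lnorm => x /=; rewrite FE.
apply: le_L2norm.
- exact: cmeasD.
- split; last exact: measurable_cst.
  by apply: measurable_funD; apply: measurable_cabs.
- by move=> x; rewrite FE le_cabsD.
Qed.

Lemma L2normZ (a : R[i]) f : cmeas f ->
  L2norm (fun x => a * f x) = ((cabs a)%:E * L2norm f)%E.
Proof.
move=> mf; rewrite !L2normE.
under eq_integral do rewrite cabsM exprMn EFinM.
rewrite ge0_integralZl//; last 3 first.
- exact: measurable_sqr_cabs.
- by move=> x _; rewrite lee_fin sqr_ge0.
- by rewrite lee_fin sqr_ge0.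
rewrite poweRM ?lee_fin ?sqr_ge0//; last first.
  by apply: integral_ge0 => x _; rewrite lee_fin sqr_ge0.
congr (_ * _)%E; rewrite poweR_EFin powR12_sqrt ?sqr_ge0//.
by rewrite sqrtr_sqr ger0_norm ?cabs_ge0.
Qed.

Lemma aeeq_L2norm f g : cmeas f -> cmeas g -> aeeq f g -> L2norm f = L2norm g.
Proof.
move=> mf mg fg; rewrite !L2normE; congr (_ `^ _)%E.
apply: ae_eq_integral => //.
- exact: measurable_sqr_cabs.
- exact: measurable_sqr_cabs.
- by apply: ae_imp fg => x -> _.
Qed.

Lemma L2norm_eq0 f : cmeas f -> L2norm f = 0%E -> aeeq f (fun=> 0).
Proof.
move=> mf /Lnorm_eq0_eq0 h.
have := h (measurableT_comp (@EFin_measurable R setT) (measurable_cabs mf)).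
rewrite lte_fin => /(_ (ltr0n _ 2)).
by apply: ae_imp => x /= /(_ I)[] /cabs_eq0.
Qed.

(** Real-valued norm, convenient for arithmetic. As [fine] sends [+oo] to 0, it is meaningful only
    under [inL2]. *)
Definition nrm f : R := fine (L2norm f).

Lemma nrm_ge0 f : 0 <= nrm f.
Proof. exact/fine_ge0/L2norm_ge0. Qed.

Lemma nrmK f : inL2 f -> ((nrm f)%:E = L2norm f)%E.
Proof. by case=> _ _ foo; rewrite /nrm fineK// ge0_fin_numE// L2norm_ge0. Qed.

Lemma inL2D f g : inL2 f -> inL2 g -> inL2 (fun x => f x + g x).
Proof.
move=> /inL2P[mf foo] /inL2P[mg goo]; apply/inL2P; split; first exact: cmeasD.
by rewrite (le_lt_trans (L2normD mf mg))// lte_add_pinfty.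
Qed.

Lemma inL2Z (a : R[i]) f : inL2 f -> inL2 (fun x => a * f x).
Proof.
move=> /inL2P[mf foo]; apply/inL2P; split; first exact: cmeasZ.
by rewrite L2normZ// lte_mul_pinfty// lee_fin cabs_ge0.
Qed.

Lemma inL2N f : inL2 f -> inL2 (fun x => - f x).
Proof. by move=> /(inL2Z (-1)); under eq_fun do rewrite mulN1r. Qed.

Lemma inL2B f g : inL2 f -> inL2 g -> inL2 (fun x => f x - g x).
Proof. by move=> hf /inL2N; exact: inL2D. Qed.

Lemma inL2_0 : inL2 (fun=> 0 : R[i]).
Proof.
split; [exact: measurable_cst|exact: measurable_cst|].
rewrite L2normE; under eq_integral do rewrite cabs0 expr0n.
by rewrite integral0 poweR0r// invr_eq0.
Qed.

Lemma nrmD f g : inL2 f -> inL2 g -> nrm (fun x => f x + g x) <= nrm f + nrm g.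
Proof.
move=> hf hg; rewrite -lee_fin EFinD !nrmK//; last exact: inL2D.
by apply: L2normD; exact: inL2_meas.
Qed.

Lemma nrmZ (a : R[i]) f : inL2 f -> nrm (fun x => a * f x) = cabs a * nrm f.
Proof.
move=> hf; apply: EFin_inj; rewrite EFinM !nrmK//; last exact: inL2Z.
by apply: L2normZ; exact: inL2_meas.
Qed.

Lemma nrmN f : inL2 f -> nrm (fun x => - f x) = nrm f.
Proof.
move=> hf; under eq_fun do rewrite -mulN1r.
by rewrite nrmZ// cabsN -[1]/(1%:C) cabs_real normr1 mul1r.
Qed.

Lemma nrmB f g : inL2 f -> inL2 g -> nrm (fun x => f x - g x) <= nrm f + nrm g.
Proof.
move=> hf hg; rewrite -(nrmN hg); apply: (nrmD hf); exact: inL2N.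
Qed.

Lemma nrm0 : nrm (fun=> 0) = 0.
Proof.
have := nrmZ 0 inL2_0; under eq_fun do rewrite mul0r.
by rewrite cabs0 mul0r.
Qed.

Lemma aeeq_nrm f g : inL2 f -> inL2 g -> aeeq f g -> nrm f = nrm g.
Proof. by move=> hf hg fg; rewrite /nrm (aeeq_L2norm _ _ fg)//; exact: inL2_meas. Qed.

Lemma nrm_eq0 f : inL2 f -> nrm f = 0 -> aeeq f (fun=> 0).
Proof.
move=> hf f0; apply: L2norm_eq0; first exact: inL2_meas.
by rewrite -nrmK// f0.
Qed.

Lemma sqr_nrm f : inL2 f -> ((nrm f ^+ 2)%:E = \int[mu]_x ((cabs (f x)) ^+ 2)%:E)%E.
Proof. by move=> hf; rewrite -sqr_L2norm -nrmK. Qed.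

Lemma inL2_sqr f (r : R) : cmeas f -> 0 <= r ->
  (\int[mu]_x ((cabs (f x)) ^+ 2)%:E <= (r ^+ 2)%:E)%E -> inL2 f /\ nrm f <= r.
Proof.
move=> mf r0 h.
suff nr : (L2norm f <= r%:E)%E.
  have hf : inL2 f by apply/inL2P; split => //; rewrite (le_lt_trans nr)// ltry.
  by split => //; rewrite -lee_fin nrmK.
have -> : r%:E = (((r ^+ 2)%:E) `^ 2^-1)%E.
  by rewrite poweR_EFin powR12_sqrt ?sqr_ge0// sqrtr_sqr ger0_norm.
rewrite L2normE gt0_ler_poweR ?invr_ge0//.
- by rewrite in_itv/= leey andbT integral_ge0// => x _; rewrite lee_fin sqr_ge0.
- by rewrite in_itv/= leey andbT lee_fin sqr_ge0.
Qed.

End L2norm_theory.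

(** * Completeness of L^2 *)

Section L2_completeness.
Context {R : realType}.
Notation mu := (@lebesgue_measure R).

(** The sequence is its first term plus a telescoping series, which converges absolutely by
    comparison with a geometric series. *)
Lemma cvgn_geometric_increments (a : nat -> R) (K : R) :
  (forall n, `|a n.+1 - a n| <= K * (2^-1) ^+ n) -> cvgn a.
Proof.
move=> aK.
have -> : a = (fun n => a 0%N + series (telescope a) n).
  by apply/funext => n; rewrite -eq_sum_telescope.
apply: is_cvgD; first exact: is_cvg_cst.
apply: normed_cvg.
have g : cvgn (series (geometric K (2^-1 : R))).
  by apply: is_cvg_geometric_series; rewrite ger0_norm// invf_lt1// ltr1n.
apply: (series_le_cvg _ _ _ g) => n /=.
- exact: normr_ge0.
- exact: le_trans (aK n).
- exact: aK.
Qed.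

Lemma limn_einf_le (v : nat -> \bar R) (c : \bar R) :
  (forall n, (v n <= c)%E) -> (limn_einf v <= c)%E.
Proof.
move=> vc; rewrite limn_einf_lim; apply: lime_le.
  exact: is_cvg_einfs.
by apply: nearW => n; apply: le_trans (vc n); apply: ereal_inf_lbound; exists n => /=.
Qed.

Lemma nrm_geometric_increments (u : nat -> R -> R[i]) :
  (forall n, inL2 (u n)) ->
  (forall n, nrm (fun x => u n.+1 x - u n x) <= (3^-1) ^+ n) ->
  forall n m, nrm (fun x => u (n + m)%N x - u n x) <= 3 / 2 * (3^-1) ^+ n.
Proof.
move=> hu hd n m.
(* The stronger bound is the exact value of the sum of [3^-k] for [n <= k < n + m], which makes the
   induction on [m] close. *)
suff : nrm (fun x => u (n + m)%N x - u n x) <=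
    3 / 2 * ((3^-1) ^+ n - (3^-1) ^+ (n + m)).
  move=> /le_trans; apply; rewrite ler_wpM2l// ?divr_ge0// gerBl.
  by rewrite exprn_ge0// invr_ge0.
elim: m => [|m IH].
  rewrite addn0 subrr mulr0; under eq_fun do rewrite subrr.
  by rewrite nrm0.
rewrite addnS.
have -> : (fun x => u (n + m).+1 x - u n x) =
    (fun x => (u (n + m).+1 x - u (n + m)%N x) + (u (n + m)%N x - u n x)).
  by apply/funext => x; rewrite addrA subrK.
apply: le_trans (nrmD (inL2B (hu _) (hu _)) (inL2B (hu _) (hu _))) _.
apply: le_trans (lerD (hd _) IH) _.
by rewrite exprS; lra.
Qed.

(** Since [4/9 < 1], the squares weighted by [4^n] still have a finite total integral. Their sum is
    thus finite almost everywhere, and each term is at most that sum. *)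
Lemma ae_geometric_increments (d : nat -> R -> R[i]) :
  (forall n, inL2 (d n)) -> (forall n, nrm (d n) <= (3^-1) ^+ n) ->
  {ae mu, forall x, exists K : R, forall n, cabs (d n x) <= K * (2^-1) ^+ n}.
Proof.
move=> hd hn.
pose w n x : \bar R := (4 ^+ n * cabs (d n x) ^+ 2)%:E.
have mw n : measurable_fun setT (w n).
  apply/measurable_EFinP; apply: measurable_funM => //.
  by apply: measurable_funX; apply: measurable_cabs; exact: inL2_meas.
have w0 n x : (0 <= w n x)%E by rewrite lee_fin mulr_ge0 ?exprn_ge0// cabs_ge0.
have msum : measurable_fun setT (fun x => \sum_(n <oo) w n x)%E.
  by apply: ge0_emeasurable_sum => // n x _ _.
have iw n : (\int[mu]_x w n x <= ((4 / 9) ^+ n)%:E)%E.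
  rewrite /w; under eq_integral do rewrite EFinM.
  rewrite ge0_integralZl//; last 2 first.
  - by apply: measurable_sqr_cabs; exact: inL2_meas.
  - by move=> x _; rewrite lee_fin sqr_ge0.
  - rewrite -sqr_nrm// -EFinM lee_fin.
    have -> : (4 / 9 : R) = 4 * (3^-1) ^+ 2 by field.
    rewrite exprMn ler_wpM2l ?exprn_ge0// exprAC.
    by rewrite lerXn2r// nnegrE ?nrm_ge0// exprn_ge0// invr_ge0.
have fin : (\int[mu]_x (\sum_(n <oo) w n x) < +oo)%E.
  rewrite integral_nneseries//.
  apply: le_lt_trans (lee_nneseries _ (fun n _ => iw n)) _.
    by move=> n _ _; exact: integral_ge0.
  have c : series (geometric (1 : R) (4 / 9)) @ \oo --> (1 / (1 - 4 / 9) : R).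
    by apply: cvg_geometric_series; rewrite ger0_norm// ltr_pdivrMr// mul1r ltr_nat.
  rewrite (_ : (\sum_(_ <oo) _)%E = (1 / (1 - 4 / 9) : R)%:E) ?ltry//.
  apply/cvg_lim => //.
  have -> : (fun n => \sum_(0 <= i < n) ((4 / 9 : R) ^+ i)%:E)%E =
      EFin \o series (geometric 1 (4 / 9)).
    apply/funext => n /=; rewrite sumEFin; congr EFin.
    by apply: eq_bigr => i _; rewrite /= mul1r.
  by apply: cvg_EFin => //; exact: nearW.
have /integrable_ae : mu.-integrable setT (fun x => \sum_(n <oo) w n x)%E.
  apply/integrableP; split => //.
  by under eq_integral do rewrite gee0_abs ?nneseries_ge0//.
move=> /(_ measurableT); apply: ae_imp => x /(_ I) fx.
set s := (\sum_(n <oo) w n x)%E in fx.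
have s0 : 0 <= fine s by rewrite fine_ge0// nneseries_ge0.
(* From [(2^n |d n x|)^2 <= s] one gets [2^n |d n x| <= 1 + s], since [s <= (1 + s)^2]. *)
exists (1 + fine s) => n.
have : (w n x <= s)%E.
  apply: le_trans (nneseries_lim_ge n.+1 _) => //.
  by rewrite big_nat_recr//= leeDr// sume_ge0.
rewrite -(fineK fx) lee_fin => h.
rewrite -(@ler_pM2l _ (2 ^+ n)) ?exprn_gt0// mulrCA -exprMn divff// expr1n mulr1.
rewrite -(@ler_sqr _) ?nnegrE ?mulr_ge0 ?addr_ge0 ?exprn_ge0 ?cabs_ge0//.
rewrite exprMn -exprM mulnC exprM (_ : 2 ^+ 2 = 4 :> R); last by ring.
by apply: (le_trans h); nra.
Qed.

(** Riesz-Fischer for rapidly Cauchy sequences: the increments are summable almost everywhere, so a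
    pointwise limit exists there, and Fatou's lemma carries the distance bounds over to it. *)
Lemma L2_complete (u : nat -> R -> R[i]) :
  (forall n, inL2 (u n)) ->
  (forall n, nrm (fun x => u n.+1 x - u n x) <= (3^-1) ^+ n) ->
  exists2 f, inL2 f & forall n, nrm (fun x => f x - u n x) <= 3 / 2 * (3^-1) ^+ n.
Proof.
move=> hu hd.
(* Upper limits are defined at every point and measurable; they are the limits wherever these exist,
   and the values elsewhere fill a null set. *)
pose f x := fine (limn_esup (fun n => (repart (u n) x)%:E)) +i*
            fine (limn_esup (fun n => (impart (u n) x)%:E)).
have mf : cmeas f.
  split.
    apply: measurableT_comp; first exact: fine_measurable.
    by apply: measurable_fun_limn_esup => n; apply/measurable_EFinP; case: (hu n).
  apply: measurableT_comp; first exact: fine_measurable.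
  by apply: measurable_fun_limn_esup => n; apply/measurable_EFinP; case: (hu n).
have good : {ae mu, forall x, repart (u n) x @[n --> \oo] --> repart f x /\
                              impart (u n) x @[n --> \oo] --> impart f x}.
  have := ae_geometric_increments (fun n => inL2B (hu n.+1) (hu n)) hd.
  apply: ae_imp => x [K hK].
  have key (v : nat -> R) : (forall n, `|v n.+1 - v n| <= K * (2^-1) ^+ n) ->
      v @ \oo --> fine (limn_esup (fun n => (v n)%:E)).
    move=> /cvgn_geometric_increments /cvg_ex[l vl].
    have /cvg_limn_einf_sup[_ ->] : (fun n => (v n)%:E) @ \oo --> l%:E.
      by apply: cvg_EFin => //; exact: nearW.
    exact: vl.
  split; apply: key => n; apply: le_trans (hK n).
    have := ler_Re_cabs (u n.+1 x - u n x); rewrite complexReD /repart.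
    by case: (u n x) => a b /=.
  have := ler_Im_cabs (u n.+1 x - u n x); rewrite complexImD /impart.
  by case: (u n x) => a b /=.
have close n : inL2 (fun x => f x - u n x) /\
    nrm (fun x => f x - u n x) <= 3 / 2 * (3^-1) ^+ n.
  have mfn : cmeas (fun x => f x - u n x).
    have -> : (fun x => f x - u n x) = (fun x => f x + -1 * u n x).
      by apply/funext => x; rewrite mulN1r.
    by apply: cmeasD => //; apply: cmeasZ; exact: inL2_meas.
  apply: inL2_sqr => //.
  pose v m x : \bar R := ((cabs (u (n + m)%N x - u n x)) ^+ 2)%:E.
  have mv m : measurable_fun setT (v m).
    by apply: measurable_sqr_cabs; apply: inL2_meas; exact: inL2B.
  have v0 m x : (0 <= v m x)%E by rewrite lee_fin sqr_ge0.
  (* Almost everywhere [|f - u n|^2] is the limit of [|u (n + m) - u n|^2] in [m], hence its lower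
     limit, to which Fatou's lemma applies. *)
  rewrite (@ge0_ae_eq_integral _ _ _ mu setT _ (fun x => limn_einf (v^~ x)))//; last 5 first.
  - exact: measurable_sqr_cabs.
  - rewrite (_ : (fun x => _) = (fun x => - limn_esup (-%E \o v^~ x))%E); last first.
      by apply/funext => x; rewrite limn_esupN oppeK.
    apply: measurableT_comp => //; apply: measurable_fun_limn_esup => m.
    exact: (@measurableT_comp _ _ _ _ _ _ -%E _ (v m)).
  - by move=> x _; rewrite lee_fin sqr_ge0.
  - move=> x _; rewrite limn_einf_lim; apply: lime_ge; first exact: is_cvg_einfs.
    by apply: nearW => k; apply: le_ereal_inf_tmp => _ [m /= _ <-].
  - apply: ae_imp good => x [ch1 ch2] _; apply/esym.
    suff /cvg_limn_einf_sup[] : v^~ x @ \oo --> ((cabs (f x - u n x)) ^+ 2)%:E by [].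
    apply: cvg_EFin; first exact: nearW.
    rewrite sqr_cabs.
    have -> : (fine \o v^~ x) = (fun m =>
        (repart (u (m + n)%N) x - repart (u n) x) ^+ 2 +
        (impart (u (m + n)%N) x - impart (u n) x) ^+ 2).
      apply/funext => m; rewrite /v /= sqr_cabs addnC.
      by rewrite /repart /impart; case: (u (m + n)%N x); case: (u n x).
    rewrite (_ : complex.Re (f x - u n x) = repart f x - repart (u n) x); last first.
      by rewrite complexReD /repart; case: (u n x).
    rewrite (_ : complex.Im (f x - u n x) = impart f x - impart (u n) x); last first.
      by rewrite complexImD /impart; case: (u n x).
    apply: cvgD; apply: cvgM; apply: cvgB; try exact: cvg_cst;
      by rewrite (cvg_shiftn n (fun m => _ (u m) x)).
  apply: le_trans (fatou _ _ _ _) _ => //.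
  apply: limn_einf_le => m.
  rewrite -sqr_nrm; last exact: inL2B.
  rewrite lee_fin lerXn2r// ?nnegrE ?nrm_ge0//.
  exact: nrm_geometric_increments.
exists f; last by move=> n; case: (close n).
have -> : f = (fun x => (f x - u 0%N x) + u 0%N x).
  by apply/funext => x; rewrite subrK.
by apply: inL2D => //; case: (close 0%N).
Qed.

End L2_completeness.

(** * Uniform boundedness of a semigroup near 0 *)

(** Linearity is required almost everywhere only, because operators act on representatives of
    classes. *)
Definition L2_operator (R : realType) (T : (R -> R[i]) -> (R -> R[i])) :=
  [/\ forall f, inL2 f -> inL2 (T f),
      forall (a : R[i]) f g, inL2 f -> inL2 g ->
        aeeq (T (fun x => a * f x + g x)) (fun x => a * T f x + T g x) &
      exists M : R, forall f, inL2 f -> nrm (T f) <= M * nrm f].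

Section uniform_boundedness.
Context {R : realType}.
Implicit Types (T : (R -> R[i]) -> (R -> R[i])) (f g : R -> R[i]).

Lemma nrm_lin T (a : R[i]) f g : L2_operator T -> inL2 f -> inL2 g ->
  nrm (T (fun x => a * f x + g x)) = nrm (fun x => a * T f x + T g x).
Proof.
move=> [TL Tl _] hf hg; apply: aeeq_nrm; last exact: Tl.
  by apply: TL; apply: inL2D => //; exact: inL2Z.
by apply: inL2D; [apply: inL2Z|]; exact: TL.
Qed.

(** This is the linearity clause with [g = 0]; the operator bound forces [T 0] to vanish almost
    everywhere. *)
Lemma nrm_opZ T (a : R[i]) f : L2_operator T -> inL2 f ->
  nrm (T (fun x => a * f x)) = cabs a * nrm (T f).
Proof.
move=> hT hf; have [TL _ [M hM]] := hT.
have nT0 : nrm (T (fun=> 0)) = 0.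
  apply/eqP; rewrite eq_le nrm_ge0 andbT.
  by apply: le_trans (hM _ inL2_0) _; rewrite nrm0 mulr0.
have T0 : aeeq (T (fun=> 0)) (fun=> 0) by apply: nrm_eq0 => //; apply: TL; exact: inL2_0.
have := nrm_lin a hT hf inL2_0.
rewrite (_ : (fun x => a * f x + 0) = (fun x => a * f x)); last first.
  by apply/funext => x; rewrite addr0.
move=> ->; rewrite -nrmZ; last exact: TL.
apply: aeeq_nrm.
- by apply: inL2D; [apply: inL2Z|]; apply: TL => //; exact: inL2_0.
- by apply: inL2Z; exact: TL.
- by apply: ae_imp T0 => x ->; rewrite addr0.
Qed.

Lemma nrm_opD T f g : L2_operator T -> inL2 f -> inL2 g ->
  nrm (T (fun x => f x + g x)) = nrm (fun x => T f x + T g x).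
Proof.
move=> hT hf hg; have := nrm_lin 1 hT hf hg.
rewrite (_ : (fun x => 1 * f x + g x) = (fun x => f x + g x)); last first.
  by apply/funext => x; rewrite mul1r.
move=> ->; congr nrm; by apply/funext => x; rewrite mul1r.
Qed.

Lemma nrm_opB T f g : L2_operator T -> inL2 f -> inL2 g ->
  nrm (T (fun x => f x - g x)) = nrm (fun x => T f x - T g x).
Proof.
move=> hT hf hg; have := nrm_lin (-1) hT hg hf.
rewrite (_ : (fun x => -1 * g x + f x) = (fun x => f x - g x)); last first.
  by apply/funext => x; rewrite mulN1r addrC.
move=> ->; congr nrm; by apply/funext => x; rewrite mulN1r addrC.
Qed.

Lemma le_nrm_op2 T f e (M : R) : L2_operator T -> inL2 f -> inL2 e ->
  (forall f, inL2 f -> nrm (T f) <= M * nrm f) ->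
  nrm (T f) <= nrm (T e) + M * nrm (fun x => f x - e x).
Proof.
move=> hT hf he hM; have [TL _ _] := hT.
apply: le_trans (lerD (lexx _) (hM _ (inL2B hf he))).
rewrite nrm_opB//; have := nrmD (TL _ he) (inL2B (TL _ hf) (TL _ he)).
by under eq_fun do rewrite addrC subrK.
Qed.

(** [eM.2] is the operator norm, the supremum of [nrm (T e)] over unit vectors, and [eM.1] is a unit
    vector that attains it up to a factor [2/3]. Normalizing the given [f] shows that the supremum
    exceeds [K]. *)
Lemma almost_norming T (K : R) : L2_operator T -> 0 <= K ->
  (exists2 f, inL2 f & K * nrm f < nrm (T f)) ->
  exists eM : (R -> R[i]) * R, [/\ inL2 eM.1, nrm eM.1 <= 1, K < eM.2,
    (forall f, inL2 f -> nrm (T f) <= eM.2 * nrm f) & 2 / 3 * eM.2 <= nrm (T eM.1)].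
Proof.
move=> hT K0 [f0 hf0 Kf0]; have [TL _ [M0 hM0]] := hT.
have unit f : inL2 f -> 0 < nrm f -> exists2 e, inL2 e & nrm e = 1 /\
    nrm (T f) = nrm f * nrm (T e).
  move=> hf f_gt0; exists (fun x => ((nrm f)^-1)%:C * f x); first exact: inL2Z.
  rewrite nrmZ// nrm_opZ// cabs_real ger0_norm ?invr_ge0 ?nrm_ge0//.
  by rewrite mulVf ?gt_eqF// mulrA divff ?gt_eqF// mul1r.
have pos f : inL2 f -> nrm f = 0 -> nrm (T f) = 0.
  move=> hf f00; apply/eqP; rewrite eq_le nrm_ge0 andbT.
  by apply: le_trans (hM0 _ hf) _; rewrite f00 mulr0.
have f0_gt0 : 0 < nrm f0.
  rewrite lt_neqAle nrm_ge0 andbT eq_sym; apply/eqP => f00.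
  by move: Kf0; rewrite (pos f0)// f00 mulr0 ltxx.
have [e0 he0 [ne0 Te0]] := unit _ hf0 f0_gt0.
have Ke0 : K < nrm (T e0).
  by move: Kf0; rewrite Te0 mulrC ltr_pM2l.
pose A := [set r : R | exists2 e, inL2 e & nrm e = 1 /\ nrm (T e) = r].
have supA : has_sup A.
  split; first by exists (nrm (T e0)), e0.
  exists M0 => _ [e he [ne <-]]; by apply: le_trans (hM0 _ he) _; rewrite ne mulr1.
have le_sup e : inL2 e -> nrm e = 1 -> nrm (T e) <= sup A.
  by move=> he ne; apply: sup_upper_bound => //; exists e.
have Ks : K < sup A by exact: lt_le_trans (le_sup _ he0 ne0).
have s0 : 0 < sup A by exact: le_lt_trans Ks.
(* A slack of a third of the supremum leaves the factor [2/3]. *)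
have [|_ [e he [ne <-]] hse] := @sup_adherent _ A (sup A / 3) _ supA.
  by rewrite divr_gt0.
exists (e, sup A); split => //=.
- by rewrite ne.
- move=> f hf; have [f00|] := eqVneq (nrm f) 0; first by rewrite pos// f00 mulr0.
  move=> fN0; have f_gt0 : 0 < nrm f by rewrite lt_neqAle eq_sym fN0 nrm_ge0.
  have [e' he' [ne' ->]] := unit _ hf f_gt0.
  by rewrite mulrC ler_pM2r// le_sup.
- by apply: le_trans (ltW hse); lra.
Qed.

(* One of [T k (u + v)] and [T k (u - v)] is at least as large as [T k v], whatever
   the current sum [u] is: thanks to the choice of sign, the gliding hump needs no
   control on the previous steps. *)
Lemma condensation_of_singularities (T : nat -> (R -> R[i]) -> (R -> R[i])) :
  (forall k, L2_operator (T k)) ->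
  (forall k, exists2 f, inL2 f & 4 ^+ k * nrm f < nrm (T k f)) ->
  exists2 x, inL2 x & forall k, (4 / 3) ^+ k / 6 <= nrm (T k x).
Proof.
move=> hT hbad.
have h4 k : (0 : R) <= 4 ^+ k by rewrite exprn_ge0.
have /choice[eM heM] := fun k => almost_norming (hT k) (h4 k) (hbad k).
pose e k := (eM k).1; pose M k := (eM k).2.
have he k : inL2 (e k) by case: (heM k).
(* The k-th hump has size [3^-k], so the humps after it add up to at most [q k / 2]. The k-th one
   contributes at least [2/3 * q k * M k], the later ones cost at most [1/2 * q k * M k], and
   [1/6 * q k * M k] survives; moreover [q k * M k] is at least [(4/3)^k]. *)
pose q k : R := (3^-1) ^+ k.
have q0 k : 0 <= q k by rewrite exprn_ge0 ?invr_ge0.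
pose v k := fun x => (q k)%:C * e k x.
have hv k : inL2 (v k) by exact: inL2Z.
have nv k : nrm (v k) <= q k.
  rewrite nrmZ// cabs_real ger0_norm// ler_piMr//; by case: (heM k).
pose step k (u : R -> R[i]) := if nrm (T k (v k)) <= nrm (T k (fun x => u x + v k x))
  then (fun x => u x + v k x) else (fun x => u x - v k x).
pose fix u k : R -> R[i] := if k is k'.+1 then step k' (u k') else (fun=> 0).
have hu k : inL2 (u k).
  elim: k => [|k IH] /=; first exact: inL2_0.
  by rewrite /step; case: ifP => _; [exact: inL2D|exact: inL2B].
have hd k : nrm (fun x => u k.+1 x - u k x) <= q k.
  apply: le_trans (nv k); rewrite /= /step; case: ifP => _.
    by under eq_fun do rewrite addrAC subrr add0r.
  by under eq_fun do rewrite addrAC subrr add0r; rewrite nrmN.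
have hTu k : nrm (T k (v k)) <= nrm (T k (u k.+1)).
  rewrite /= /step; case: ifP => // /negbT; rewrite -ltNge => lt1.
  have [TL _ _] := hT k.
  (* The images of [u + v] and [u - v] differ by [2 T v], so if the plus sign falls short the minus
     sign does not. *)
  have : 2 * nrm (T k (v k)) <=
      nrm (T k (fun x => u k x + v k x)) + nrm (T k (fun x => u k x - v k x)).
    rewrite nrm_opD// nrm_opB//.
    have := nrmB (inL2D (TL _ (hu k)) (TL _ (hv k))) (inL2B (TL _ (hu k)) (TL _ (hv k))).
    apply: le_trans.
    rewrite (_ : (fun x => _) = (fun x => (2 : R)%:C * T k (v k) x)); last first.
      by apply/funext => x; rewrite rmorphMn /= rmorph1; ring.
    by rewrite nrmZ ?cabs_real ?ger0_norm//; exact: TL.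
  by move: lt1; lra.
have [x hx hxu] := L2_complete hu hd.
exists x => // k.
have [_ _ KM hM hTe] := heM k.
have := le_nrm_op2 (hT k) (hu k.+1) hx hM.
have : q k * (2 / 3 * M k) <= nrm (T k (u k.+1)).
  apply: le_trans (hTu k).
  by rewrite nrm_opZ// cabs_real ger0_norm// ler_wpM2l.
have M0 : 0 <= M k by apply: le_trans (ltW KM); rewrite exprn_ge0.
have : nrm (fun y => u k.+1 y - x y) <= q k / 2.
  rewrite -nrmN; last exact: inL2B.
  under eq_fun do rewrite opprB.
  by apply: le_trans (hxu _) _; rewrite exprS -/(q k); lra.
move=> /(ler_wpM2l M0) h1 h2 h3.
have : (4 / 3) ^+ k <= q k * M k.
  by rewrite expr_div_n -exprVn mulrC ler_wpM2l// ltW.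
move: h1 h2 h3; rewrite -/(M k).
set a := nrm (T k (u k.+1)); set b := nrm (fun y => _); set c := nrm (T k x).
by move=> *; lra.
Qed.

Lemma semigroup_L2_operator S (t : R) : C0_semigroup S -> 0 <= t -> L2_operator (S t).
Proof.
move=> hS t0; split.
- by move=> f; exact: sg_L2.
- by move=> a f g; exact: sg_linear.
- have [M hM] := sg_bounded hS t0; exists M => f hf.
  by rewrite -lee_fin EFinM !nrmK ?hM//; exact: sg_L2.
Qed.

Lemma semigroup_nrm_cont S f : C0_semigroup S -> inL2 f ->
  nrm (fun x => S t f x - f x) @[t --> 0^'+] --> (0 : R).
Proof. by move=> hS hf; apply: fine_cvg; exact: sg_cont. Qed.

(** Otherwise there are times [t k <= 1/(k+1)] at which the operator norm exceeds [4^k].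
    Condensation yields one [x] with [nrm (S (t k) x)] unbounded, against the strong continuity of
    the semigroup at 0. *)
Lemma semigroup_bounded_near0 S : C0_semigroup S ->
  exists Md : R * R, [/\ 0 < Md.2, 0 <= Md.1 &
    forall t f, 0 <= t -> t <= Md.2 -> inL2 f -> nrm (S t f) <= Md.1 * nrm f].
Proof.
move=> hS; apply: contrapT => hno.
have bad k : exists t : R, [/\ 0 <= t, t <= k.+1%:R^-1 &
    exists2 f, inL2 f & 4 ^+ k * nrm f < nrm (S t f)].
  apply: contrapT => h; apply: hno; exists (4 ^+ k, k.+1%:R^-1); split => //=.
  move=> t f t0 tk hf; rewrite leNgt; apply/negP => hlt.
  by apply: h; exists t; split => //; exists f.
have /choice[t ht] := bad.
have t0 k : 0 <= t k by case: (ht k).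
have [x hx hk] := condensation_of_singularities
  (fun k => semigroup_L2_operator hS (t0 k)) (fun k => let: And3 _ _ h := ht k in h).
have bnd : \forall k \near \oo, nrm (S (t k) x) <= nrm x + 1.
  have /cvgrPdist_lt/(_ 1 ltr01) := semigroup_nrm_cont hS hx.
  rewrite near_withinE => /nbhs_ballP[d /= d0 hd].
  have : (fun k => k.+1%:R^-1 : R) @ \oo --> (0 : R) by exact: cvg_harmonic.
  move=> /cvgrPdist_lt/(_ d d0); apply: filterS => k hkd.
  (* The limit at [0^'+] says nothing about time 0 itself, where [S 0 x = x] is used instead. *)
  have [tk0|tk0] := eqVneq (t k) 0.
    rewrite tk0 (aeeq_nrm _ _ (sg_id hS hx))//; last exact: sg_L2.
    by rewrite lerDl.
  have tkp : 0 < t k by rewrite lt_neqAle eq_sym tk0 t0.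
  have tkd : ball 0 d (t k).
    rewrite /ball/= sub0r normrN ger0_norm//.
    case: (ht k) => _ /le_lt_trans -> //.
    by move: hkd; rewrite sub0r normrN ger0_norm// invr_ge0.
  have := hd _ tkd tkp; rewrite sub0r normrN ger0_norm ?nrm_ge0// => h1.
  have hSx : inL2 (S (t k) x) by exact: sg_L2.
  have := nrmD (inL2B hSx hx) hx.
  under eq_fun do rewrite subrK.
  by move/le_trans; apply; rewrite addrC lerD2l ltW.
have bern k : 1 + k%:R / 3 <= (4 / 3 : R) ^+ k.
  elim: k => [|k IH]; first by rewrite mul0r addr0.
  rewrite exprS -natr1; have : 0 <= k%:R / 3 :> R by rewrite divr_ge0.
  by move: IH; set y := _ ^+ k; set z := k%:R => *; lra.
have big : \forall k \near \oo, nrm x + 1 < (4 / 3) ^+ k / 6.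
  (* By Bernoulli [(4/3)^k / 6] exceeds [k / 18], whence the constant 18. *)
  have := nbhs_infty_gtr (18 * (nrm x + 1)); apply: filterS => k hk'.
  by have := bern k; set y := _ ^+ k => *; lra.
have [k []] := @filter_ex _ _ _ _ (filterI bnd big).
by move=> h1 h2; have := lt_le_trans h2 (le_trans (hk k) h1); rewrite ltxx.
Qed.

End uniform_boundedness.

(** * Orbits of eigenvectors of the generator *)

(** The upper bound on [expR y] comes from [expR (- y) >= 1 - y], that is [expR y <= 1 / (1 - y)],
    and from [(1 - y) (1 + y + 2 y^2) = 1 + y^2 (1 - 2 y)], which is at least 1 for [y <= 1/2]. *)
Lemma expR_sub1_bound (R : realType) (y : R) : 0 <= y -> y <= 2^-1 ->
  `|1 + y - expR y| <= 2 * y ^+ 2.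
Proof.
move=> y0 y2; have h1 := expR_ge1Dx y; have h2 := expR_ge1Dx (- y).
have h3 : expR y * (1 - y) <= 1.
  by rewrite -[leRHS](expRxMexpNx_1 y) ler_wpM2l ?expR_ge0.
rewrite ler_norml; apply/andP; split; last by nra.
have : expR y <= 1 + y + 2 * y ^+ 2; last by lra.
rewrite -(@ler_pM2r _ (1 - y)); last by lra.
by apply: le_trans h3 _; nra.
Qed.

Section eigenvector_orbit.
Context {R : realType}.
Context (S : R -> (R -> R[i]) -> (R -> R[i])) (psi : R -> R[i]) (lam : R).
Context (hS : C0_semigroup S) (lam0 : 0 <= lam).
Context (hgen : sg_generator S psi (fun x => lam%:C * psi x)).

Let defect t := nrm (fun x => S t psi x - (expR (lam * t))%:C * psi x).

Let hpsi : inL2 psi. Proof. by case: hgen. Qed.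

Let hdefect t : 0 <= t -> inL2 (fun x => S t psi x - (expR (lam * t))%:C * psi x).
Proof.
move=> t0; apply: (@inL2B _ _ (fun x => _ * psi x)); first exact: sg_L2.
exact: inL2Z.
Qed.

(** By the semigroup law the new error is [S t] applied to the error at time [h], plus
    [expR (lam * h)] times the error at time [t]. *)
Let defect_step t h M : 0 <= t -> 0 <= h ->
  (forall f, inL2 f -> nrm (S t f) <= M * nrm f) ->
  defect (t + h) <= M * defect h + expR (lam * h) * defect t.
Proof.
move=> t0 h0 hM; have opt := semigroup_L2_operator hS t0.
have th0 : 0 <= t + h by rewrite addr_ge0.
have hSh : inL2 (S h psi) by exact: sg_L2.
have hSt : inL2 (S t psi) by exact: sg_L2.
have hSth : inL2 (S t (S h psi)) by exact: sg_L2.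
have hZ (a : R[i]) : inL2 (fun x => a * psi x) by exact: inL2Z.
pose e := (expR (lam * h))%:C.
have -> : defect (t + h) =
    nrm (fun x => (S t (S h psi) x - e * S t psi x) +
                  e * (S t psi x - (expR (lam * t))%:C * psi x)).
  apply: aeeq_nrm; first exact: hdefect.
    apply: inL2D; last by apply: inL2Z; exact: hdefect.
    by apply: (@inL2B _ _ (fun x => e * _ x)) => //; exact: inL2Z.
  apply: ae_imp (sg_add hS t0 h0 hpsi) => x ->.
  rewrite (_ : (expR (lam * (t + h)))%:C = e * (expR (lam * t))%:C); first by ring.
  by rewrite mulrDr expRD rmorphM mulrC.
apply: le_trans (nrmD _ _) _.
- by apply: (@inL2B _ _ (fun x => e * _ x)) => //; exact: inL2Z.
- by apply: inL2Z; exact: hdefect.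
have ce : cabs e = expR (lam * h) by rewrite cabs_real ger0_norm ?expR_ge0.
rewrite (nrmZ e (hdefect t0)) ce lerD2r.
apply: le_trans (hM _ (hdefect h0)); rewrite nrm_opB//.
rewrite le_eqVlt; apply/orP; left; apply/eqP; apply: aeeq_nrm.
- by apply: (@inL2B _ _ (fun x => e * _ x)) => //; exact: inL2Z.
- by apply: inL2B => //; exact: sg_L2.
have [_ Tl _] := opt.
have T0 : aeeq (S t (fun=> 0)) (fun=> 0).
  apply: nrm_eq0; first by apply: sg_L2 => //; exact: inL2_0.
  apply/eqP; rewrite eq_le nrm_ge0 andbT.
  by apply: le_trans (hM _ inL2_0) _; rewrite nrm0 mulr0.
have := ae_and (Tl e psi _ hpsi inL2_0) T0.
rewrite (_ : (fun x => e * psi x + 0) = (fun x => e * psi x)); last first.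
  by apply/funext => x; rewrite addr0.
by apply: ae_imp => x [-> ->]; rewrite addr0.
Qed.

(** The error at time [h] is [h] times the difference quotient minus its limit [lam psi], which is
    [o(h)], plus the second-order Taylor remainder of the exponential times [psi]. *)
Let defect_small (e : R) : 0 < e ->
  \forall h \near (0 : R)^'+, defect h <= e * h.
Proof.
move=> e0.
have gen0 : nrm (fun x => (h^-1)%:C * (S h psi x - psi x) - lam%:C * psi x)
    @[h --> 0^'+] --> (0 : R).
  by apply: fine_cvg; case: hgen.
have e20 : 0 < e / 2 by rewrite divr_gt0.
have /cvgrPdist_lt/(_ _ e20) near1 := gen0.
(* The first entry gives [lam * h <= 1/2], as the exponential estimate requires; the second makes
   [2 (lam h)^2 nrm psi] at most [e h / 2]. The added ones keep the denominators positive. *)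
pose d := Num.min (2 * (1 + lam))^-1 (e / (4 * (1 + lam ^+ 2) * (1 + nrm psi))).
have d0 : 0 < d.
  rewrite lt_min invr_gt0 mulr_gt0 ?ltr_wpDr//= divr_gt0// !mulr_gt0//.
    by rewrite ltr_wpDr// sqr_ge0.
  by rewrite ltr_wpDr// nrm_ge0.
near=> h.
have h0 : 0 < h by near: h; exact: nbhs_right_gt.
have hd : h < d by near: h; exact: nbhs_right_lt.
have g1 : nrm (fun x => (h^-1)%:C * (S h psi x - psi x) - lam%:C * psi x) < e / 2.
  have : `|0 - nrm (fun x => (h^-1)%:C * (S h psi x - psi x) - lam%:C * psi x)| < e / 2.
    by near: h.
  by rewrite sub0r normrN ger0_norm ?nrm_ge0.
have hSh : inL2 (S h psi) by apply: sg_L2 => //; exact: ltW.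
have hG : inL2 (fun x => (h^-1)%:C * (S h psi x - psi x) - lam%:C * psi x).
  apply: (@inL2B _ (fun x => _ * (_ - _)) (fun x => _ * psi x)); apply: inL2Z => //.
  exact: inL2B.
have -> : defect h = nrm (fun x =>
    h%:C * ((h^-1)%:C * (S h psi x - psi x) - lam%:C * psi x) +
    (1 + lam * h - expR (lam * h))%:C * psi x).
  congr nrm; apply/funext => x.
  rewrite mulrBr mulrA -rmorphM/= divff ?gt_eqF// rmorph1 mul1r.
  rewrite !rmorphB !rmorphD !rmorphM rmorph1 /=; ring.
apply: le_trans (nrmD _ _) _; [exact: inL2Z|exact: inL2Z|].
rewrite !nrmZ// !cabs_real (gtr0_norm h0).
move: hd; rewrite lt_min => /andP[hd1 hd2].
have lh0 : 0 <= lam * h by rewrite mulr_ge0// ltW.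
have lh : lam * h <= 2^-1.
  move: hd1; rewrite -[_^-1]div1r ltr_pdivlMr; last by rewrite mulr_gt0// ltr_wpDr.
  by nra.
have := ler_wpM2r (nrm_ge0 psi) (expR_sub1_bound lh0 lh).
move: hd2; rewrite ltr_pdivlMr; last first.
  rewrite !mulr_gt0//; first by rewrite ltr_wpDr// sqr_ge0.
  by rewrite ltr_wpDr// nrm_ge0.
move: (nrm_ge0 psi) g1; set B := nrm psi; set A := nrm _; set Cc := `|_|.
move=> B0 A1 h1 h2.
have h3 : lam ^+ 2 * B <= (1 + lam ^+ 2) * (1 + B).
  by have := sqr_ge0 lam; nra.
have h4 : 2 * (lam * h) ^+ 2 * B <= e / 2 * h.
  rewrite exprMn.
  have : h * (4 * (lam ^+ 2 * B)) <= e.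
    by apply: le_trans (ltW h1); rewrite -[4 * _ * _]mulrA ler_pM2l// ler_pM2l.
  move=> h4; have -> : 2 * (lam ^+ 2 * h ^+ 2) * B = h * (4 * (lam ^+ 2 * B)) / 2 * h.
    by field.
  by rewrite ler_pM2r// ler_pM2r// invr_gt0.
have h5 : h * A <= h * (e / 2) by rewrite ler_pM2l// ltW.
by lra.
Unshelve. all: by end_near. Qed.

(** Each of the [n] steps adds an error of at most [M * defect h], and later steps amplify it by at
    most [expR (lam * (n h))]. Only the operators at times [k h] with [k < n] are applied. *)
Let defect_mul_le h M n : 0 <= h -> 0 <= M ->
  (forall k f, (k < n)%N -> inL2 f -> nrm (S (k%:R * h) f) <= M * nrm f) ->
  defect (n%:R * h) <= n%:R * (M * defect h) * expR (lam * (n%:R * h)).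
Proof.
move=> h0 M0; elim: n => [_|n IH hM].
  rewrite !mul0r /defect mulr0 expR0.
  rewrite (@aeeq_nrm _ _ (fun=> 0)) ?nrm0//.
  - by apply: (@inL2B _ _ (fun x => _ * psi x)); [exact: sg_L2|exact: inL2Z].
  - exact: inL2_0.
  - by apply: ae_imp (sg_id hS hpsi) => x ->; rewrite rmorph1 mul1r subrr.
have nh0 : 0 <= n%:R * h by rewrite mulr_ge0.
have -> : n.+1%:R * h = n%:R * h + h by rewrite -natr1 mulrDl mul1r.
apply: le_trans (defect_step nh0 h0 (fun f => hM n f (ltnSn n))) _.
have {}IH := IH (fun k f kn => hM k f (ltnW kn)).
have := ler_wpM2l (expR_ge0 (lam * h)) IH.
have e1 : 1 <= expR (lam * (n%:R * h + h)).
  by rewrite -[leLHS]expR0 ler_expR mulr_ge0 ?addr_ge0.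
have Md0 : 0 <= M * defect h by rewrite mulr_ge0// nrm_ge0.
rewrite mulrDr expRD in e1 *.
rewrite -natr1 => hh.
have := ler_wpM2l Md0 e1; rewrite mulr1; move: hh.
set a := expR (lam * h); set b := expR _; set c := M * _; set dd := _ * defect _.
by move=> *; nra.
Qed.

(** For times up to [d], where the semigroup is uniformly bounded, cutting into ever smaller steps
    sends the error to 0. Longer times are reached by steps no longer than [d], each of which is now
    exact. *)
Lemma eigenvector_orbit t : 0 <= t ->
  aeeq (S t psi) (fun x => (expR (lam * t))%:C * psi x).
Proof.
suff def0 : forall t, 0 <= t -> defect t = 0.
  move=> t0; apply: ae_imp (nrm_eq0 (hdefect t0) (def0 _ t0)) => x /eqP.
  by rewrite subr_eq0 => /eqP.
have [[M d] /= [d0 M0 hM]] := semigroup_bounded_near0 hS.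
have small s : 0 <= s -> s <= d -> defect s = 0.
  move=> s0 sd; apply/eqP; rewrite eq_le nrm_ge0 andbT.
  have [->|sN0] := eqVneq s 0.
    have := @defect_mul_le 0 M 0 (lexx _) M0; rewrite !mul0r; apply.
    by move=> k f.
  have sp : 0 < s by rewrite lt_neqAle eq_sym sN0.
  apply/ler_addgt0Pr => e e0; rewrite add0r.
  (* With [defect h <= e / c * h] the accumulated error is [e * (M s expR (lam s)) / c], at most
     [e]; the added 1 makes [c] positive. *)
  pose c := M * s * expR (lam * s) + 1.
  have c0 : 0 < c by rewrite ltr_wpDl// !mulr_ge0 ?expR_ge0.
  have := defect_small (divr_gt0 e0 c0).
  rewrite near_withinE => /nbhs_ballP[r /= r0 hr].
  have [n hn] : exists n : nat, s / n.+1%:R < r.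
    have := nbhs_infty_gtr (s / r) => /= -[N _ hN].
    exists N; rewrite ltr_pdivrMr// mulrC -ltr_pdivrMr//.
    by apply: (hN N.+1) => /=.
  pose h := s / n.+1%:R.
  have h0 : 0 < h by rewrite divr_gt0.
  have nh : n.+1%:R * h = s by rewrite mulrC divfK// pnatr_eq0.
  have dh : defect h <= e / c * h.
    by apply: hr => //; rewrite /ball/= sub0r normrN gtr0_norm.
  have := @defect_mul_le h M n.+1 (ltW h0) M0; rewrite nh.
  have bnd k f : (k < n.+1)%N -> inL2 f -> nrm (S (k%:R * h) f) <= M * nrm f.
    move=> kn; apply: hM; first by rewrite mulr_ge0// ltW.
    by apply: le_trans sd; rewrite -nh ler_pM2r// ler_nat ltnW.
  move=> /(_ bnd) /le_trans; apply.
  apply: (@le_trans _ _ (n.+1%:R * (M * (e / c * h)) * expR (lam * s))).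
    rewrite ler_wpM2r ?expR_ge0// ler_wpM2l// ler_wpM2l//.
  have -> : n.+1%:R * (M * (e / c * h)) * expR (lam * s) =
      e * ((M * (n.+1%:R * h) * expR (lam * s)) / c) by ring.
  rewrite nh ler_piMr ?(ltW e0)// ler_pdivrMr// mul1r /c lerDl//.
move=> {}t t0.
have [n hn] : exists n : nat, t / n.+1%:R <= d.
  have := nbhs_infty_gtr (t / d) => /= -[N _ hN].
  exists N; rewrite ler_pdivrMr// mulrC -ler_pdivrMr//.
  by apply/ltW/(hN N.+1) => /=.
pose h := t / n.+1%:R.
have h0 : 0 <= h by rewrite divr_ge0.
have -> : t = n.+1%:R * h by rewrite mulrC divfK// pnatr_eq0.
elim: n.+1 => [|k IH]; first by rewrite mul0r; apply: small => //; exact: ltW.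
have kh0 : 0 <= k%:R * h by rewrite mulr_ge0.
(* Any bound [K] on this single operator will do, since it multiplies [defect h = 0]. *)
have [_ _ [K hK]] := semigroup_L2_operator hS kh0.
have -> : k.+1%:R * h = k%:R * h + h by rewrite -natr1 mulrDl mul1r.
apply/eqP; rewrite eq_le nrm_ge0 andbT.
by apply: le_trans (defect_step kh0 h0 hK) _; rewrite IH small// !mulr0 addr0.
Qed.

End eigenvector_orbit.

(** * The bound state *)

Section bound_state.
Context {R : realType}.
Notation mu := (@lebesgue_measure R).
Implicit Types (x : R) (nu : nat).

(** * Hyperbolic functions and their derivatives *)

Definition sinhR x : R := (expR x - expR (- x)) / 2.

Definition sechR x : R := (coshR x)^-1.

Lemma coshR_ge1 x : 1 <= coshR x.
Proof.
rewrite /coshR ler_pdivlMr// mul1r.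
by have := expR_ge1Dx x; have := expR_ge1Dx (- x); lra.
Qed.

Lemma coshR_gt0 x : 0 < coshR x.
Proof. exact: lt_le_trans (coshR_ge1 x). Qed.

Lemma coshR_neq0 x : coshR x != 0.
Proof. by rewrite gt_eqF// coshR_gt0. Qed.

Lemma sechR_gt0 x : 0 < sechR x.
Proof. by rewrite invr_gt0 coshR_gt0. Qed.

Lemma sechR_le1 x : sechR x <= 1.
Proof. by rewrite invf_le1 ?coshR_gt0// coshR_ge1. Qed.

Lemma coshRN x : coshR (- x) = coshR x.
Proof. by rewrite /coshR opprK addrC. Qed.

Lemma sqr_coshR x : coshR x ^+ 2 - sinhR x ^+ 2 = 1.
Proof.
by rewrite -[RHS](expRxMexpNx_1 x) /coshR /sinhR; field.
Qed.

Lemma sqr_sinhR_sechR x : (sinhR x * sechR x) ^+ 2 = 1 - sechR x ^+ 2.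
Proof.
rewrite exprMn.
have -> : sinhR x ^+ 2 = coshR x ^+ 2 - 1 by rewrite -(sqr_coshR x); ring.
by rewrite /sechR; field; exact: coshR_neq0.
Qed.

Lemma sinhR_sechR_le1 x : `|sinhR x * sechR x| <= 1.
Proof.
rewrite -(@ler_sqr _) ?nnegrE// expr1n real_normK ?num_real//.
by rewrite sqr_sinhR_sechR gerBl sqr_ge0.
Qed.

Lemma is_derive_coshR x : is_derive x 1 (@coshR R) (sinhR x).
Proof.
rewrite (_ : @coshR R = (2^-1 \*: (expR + (fun y => expR (- y))))%R); last first.
  by apply/funext => y; rewrite /coshR mulrC.
by apply: is_derive_eq; rewrite /sinhR -[_ *: _]/(_ * _) mulrN1 mulrC.
Qed.

Lemma is_derive_sinhR x : is_derive x 1 sinhR (coshR x).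
Proof.
rewrite (_ : sinhR = (2^-1 \*: (expR - (fun y => expR (- y))))%R); last first.
  by apply/funext => y; rewrite /sinhR mulrC.
by apply: is_derive_eq; rewrite /coshR -[_ *: _]/(_ * _) mulrN1 opprK mulrC.
Qed.

Lemma is_derive_sechR x : is_derive x 1 sechR (- (sinhR x * sechR x ^+ 2)).
Proof.
have := is_deriveV (coshR_neq0 x) (is_derive_coshR x) => /is_derive_eq; apply.
by rewrite -[_ *: _]/(_ * _) mulNr mulrC exprVn.
Qed.

Lemma is_derive_continuous (f f' : R -> R) :
  (forall x, is_derive x 1 f (f' x)) -> continuous f.
Proof.
move=> df x; apply: differentiable_continuous; apply/derivable1_diffP.
by have [] := df x.
Qed.

Lemma continuous_sechR : continuous sechR.
Proof. exact: is_derive_continuous is_derive_sechR. Qed.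

(** Its finiteness makes [sechR] the dominating function in the integrability proofs below. By
    evenness it suffices to integrate over the half-line, where an explicit primitive is
    available. *)
Lemma integral_sechR : (\int[mu]_x (sechR x)%:E = pi%:E)%E.
Proof.
rewrite ge0_symfun_integralT; last 3 first.
- by move=> x; rewrite ltW// sechR_gt0.
- exact: continuous_sechR.
- by move=> x /=; rewrite /sechR coshRN.
rewrite -set_itvcy.
(* This is a primitive because [sech x = 2 e^(-x) / (1 + e^(-2x))]; it rises from [- pi / 2] at 0 to
   0 at infinity. *)
pose F x : R := - 2 * atan (expR (- x)).
have dF x : is_derive x 1 F (sechR x).
  rewrite (_ : F = (- 2 \*: (fun y => atan (expR (- y))))%R)//.
  apply: is_derive_eq; rewrite -[_ *: _]/(_ * _) /sechR /coshR.
  have e0 : expR (- x) != 0 by rewrite gt_eqF// expR_gt0.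
  rewrite -[X in expR X + _]opprK [expR (- - x)]expRN.
  by field; rewrite e0 ?gt_eqF//= ltr_wpDl ?sqr_ge0.
rewrite (@ge0_continuous_FTC2y _ _ F 0 (- 2 * atan 0)).
- rewrite /F oppr0 expR0 atan1 atan0 mulr0 sub0e -EFinN -EFinM.
  by congr EFin; field.
- by move=> x _; rewrite ltW// sechR_gt0.
- by apply: continuous_subspaceT; exact: continuous_sechR.
- apply: cvgMr; apply: continuous_cvg; [exact: continuous_atan|exact: cvgr_expR].
- by move=> x _; have [] := dF x.
- by apply: cvg_at_right_filter; exact: (is_derive_continuous dF).
- by move=> x _; rewrite derive1E; have [] := dF x.
Qed.

(** * Integrability by comparison with sech *)

Lemma repart_real (g : R -> R) : repart (fun x => (g x)%:C) = g.
Proof. by []. Qed.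

Lemma impart_real (g : R -> R) : impart (fun x => (g x)%:C) = fun=> 0.
Proof. by []. Qed.

Lemma integrable_sechR_dominated (g : R -> R) (K : R) :
  continuous g -> (forall x, `|g x| <= K * sechR x) ->
  mu.-integrable setT (EFin \o g).
Proof.
move=> cg gK; have mg : measurable_fun setT g by exact: continuous_measurable_fun.
apply: (@le_integrable _ _ R mu setT measurableT (EFin \o g) (fun x => (K * sechR x)%:E)).
- exact/measurable_EFinP.
- by move=> x _ /=; rewrite lee_fin (le_trans (gK x))// ler_norm.
under eq_fun do rewrite EFinM; apply: integrableZl => //.
apply/integrableP; split.
  apply/measurable_EFinP.
  exact: (continuous_measurable_fun continuous_sechR).
under eq_integral do rewrite /= ger0_norm ?ltW ?sechR_gt0//.
by rewrite integral_sechR ltry.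
Qed.

(** As [sechR <= 1], the square of [g] is dominated by [K^2 sechR] and is therefore integrable. *)
Lemma inL2_sechR_dominated (g : R -> R) (K : R) : continuous g ->
  (forall x, `|g x| <= K * sechR x) -> inL2 (fun x => (g x)%:C).
Proof.
move=> cg gK; have mg : measurable_fun setT g by exact: continuous_measurable_fun.
have [r r0 hr] : exists2 r : R, 0 <= r &
    (\int[mu]_x ((cabs (g x)%:C) ^+ 2)%:E <= (r ^+ 2)%:E)%E.
  have : mu.-integrable setT (EFin \o (fun x => g x ^+ 2)).
    apply: (@integrable_sechR_dominated _ (K ^+ 2)).
      by move=> x; apply: continuousM; exact: cg.
    move=> x; rewrite normrX.
    apply: (@le_trans _ _ ((K * sechR x) ^+ 2)).
      by rewrite lerXn2r// nnegrE (le_trans _ (gK x)).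
    rewrite exprMn ler_wpM2l ?sqr_ge0// expr2 ler_piMr ?sechR_le1//.
    by rewrite ltW ?sechR_gt0.
  move=> /integrableP[_ foo].
  set I := (\int[mu]_x _)%E in foo; have I0 : (0 <= I)%E by exact: integral_ge0.
  exists (Num.sqrt (fine I)); first exact: sqrtr_ge0.
  rewrite sqr_sqrtr ?fine_ge0// fineK ?ge0_fin_numE// le_eqVlt; apply/orP; left.
  by apply/eqP; apply: eq_integral => x _; rewrite cabs_real /= normrX.
by case: (@inL2_sqr _ (fun x => (g x)%:C) r) => //; split=> //; exact: measurable_cst.
Qed.

(** * Weak derivatives of real C^1 functions *)

Lemma cintegral_real (g : R -> R) :
  cintegral (fun x => (g x)%:C) = (\int[mu]_x g x)%:C.
Proof.
by rewrite /cintegral repart_real impart_real Rintegral_cst// mul0r.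
Qed.

Lemma Rintegral_supported (f : R -> R) (b : R) :
  (forall x, b < `|x| -> f x = 0) ->
  \int[mu]_x f x = \int[mu]_(x in `[- b, b]) f x.
Proof.
move=> f0; rewrite [RHS]Rintegral_mkcond; congr (Rintegral _ _ _).
apply/funext => x; rewrite patchE; case: ifPn => // /negP xb.
apply: f0; rewrite ltNge; apply/negP => /ler_normlP[h1 h2]; apply: xb.
by rewrite inE/= in_itv/=; apply/andP; split => //; rewrite lerNl.
Qed.

(** Integration by parts on an interval outside which the test function vanishes; the boundary terms
    are zero. *)
Lemma weak_derivative_real (g g' : R -> R) :
  (forall x, is_derive x 1 g (g' x)) -> continuous g' ->
  weak_derivative (fun x => (g x)%:C) (fun x => (g' x)%:C).
Proof.
move=> dg cg' phi [sphi [r hr]].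
have cphi : continuous phi.
  apply: (@is_derive_continuous _ (derive1 phi)) => x.
  by rewrite derive1E; apply: derivableP; exact: (sphi 0%N).
have cphi' : continuous (derive1 phi).
  apply: (@is_derive_continuous _ (derive1 (derive1 phi))) => x.
  by rewrite [X in is_derive _ _ _ X]derive1E; apply: derivableP; exact: (sphi 1%N).
under eq_fun do rewrite -rmorphM/=.
rewrite [RHS](_ : _ = - cintegral (fun x => (g' x * phi x)%:C)); last first.
  by congr (- cintegral _); apply/funext => x; rewrite rmorphM.
rewrite !cintegral_real -rmorphN/=; congr (_%:C).
(* [r] may be negative; this [b] is positive and strictly beyond [r], so [phi] vanishes at both
   endpoints. *)
pose b := `|r| + 1.
have rb x : b < `|x| -> r < `|x|.
  by apply: le_lt_trans; rewrite /b (le_trans (ler_norm r))// lerDl.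
have b0 : 0 < b by rewrite ltr_wpDl.
(* The region [|x| > b] is open and [phi] is zero on it, so [phi] is locally constant there. *)
have dphi0 x : b < `|x| -> derive1 phi x = 0.
  move=> bx; rewrite derive1E (@near_eq_derive _ _ _ phi (cst 0) x 1).
    by rewrite -derive1E derive1_cst.
  have /cvgr_gt/(_ _ bx) : `|y| @[y --> x] --> `|x| by exact: norm_continuous.
  by apply: filterS => y /rb /hr.
have phib : phi b = 0 by apply: hr; rewrite gtr0_norm// /b (le_lt_trans (ler_norm r))// ltrDl.
have phiNb : phi (- b) = 0.
  by apply: hr; rewrite normrN gtr0_norm// /b (le_lt_trans (ler_norm r))// ltrDl.
rewrite (@Rintegral_supported (fun x => g x * derive1 phi x) b); last first.
  by move=> x /dphi0 ->; rewrite mulr0.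
rewrite (@Rintegral_supported (fun x => g' x * phi x) b); last first.
  by move=> x /rb /hr ->; rewrite mulr0.
have cg := is_derive_continuous dg.
rewrite (@Rintegration_by_parts _ g phi g' (derive1 phi)).
- by rewrite phib phiNb !mulr0 subrr sub0r.
- by rewrite -subr_gt0 opprK addr_gt0.
- exact: continuous_subspaceT.
- split; first by move=> x _; have [] := dg x.
  + by apply: cvg_at_right_filter; exact: cg.
  + by apply: cvg_at_left_filter; exact: cg.
- by move=> x _; rewrite derive1E; have [] := dg x.
- exact: continuous_subspaceT.
- split; first by move=> x _; exact: (sphi 0%N).
  + by apply: cvg_at_right_filter; exact: cphi.
  + by apply: cvg_at_left_filter; exact: cphi.
- by [].
Qed.

(** * The eigenfunction [sech^nu] and its first two derivatives *)

Definition bound_state nu x : R := sechR x ^+ nu.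

Definition bound_state1 nu x : R := - (nu%:R * (sinhR x * sechR x ^+ nu.+1)).

(** The second derivative, arranged so that [- psi'' + V psi = - nu^2 psi] can be read off. *)
Definition bound_state2 nu x : R :=
  (nu ^ 2)%:R * bound_state nu x + potential nu x * bound_state nu x.

Lemma is_derive_bound_state nu x :
  is_derive x 1 (bound_state nu) (bound_state1 nu x).
Proof.
have := @is_deriveX R _ sechR nu x 1 _ (is_derive_sechR x).
rewrite (_ : sechR ^+ nu = bound_state nu); last by apply/funext => y; rewrite fctE.
move/is_derive_eq; apply; rewrite -[_ *: _]/(_ * _) /bound_state1.
by case: nu => [|n] /=; [rewrite !mul0r oppr0|rewrite !exprS; ring].
Qed.

Lemma is_derive_bound_state1 nu x :
  is_derive x 1 (bound_state1 nu) (bound_state2 nu x).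
Proof.
have dM := @is_deriveM R _ _ _ x 1 _ _ (is_derive_sinhR x) (is_derive_bound_state nu.+1 x).
have := @is_deriveZ _ _ _ _ (- nu%:R) x 1 _ dM.
rewrite (_ : _ \*: _ = bound_state1 nu); last first.
  by apply/funext => y; rewrite /bound_state1 -mulNr.
move/is_derive_eq; apply; rewrite -![_ *: _]/(_ * _).
rewrite /bound_state2 /bound_state1 /potential /bound_state.
have sh2 : sinhR x ^+ 2 = coshR x ^+ 2 - 1 by rewrite -(sqr_coshR x); ring.
rewrite -mulnn !natrM -natr1 !exprS !expr0 /sechR.
set P := _ ^+ nu; set n := nu%:R; set c := coshR x; set s := sinhR x.
(* The product rule gives this form; replacing [sinh^2] by [cosh^2 - 1] then turns the coefficient
   [nu (nu + 1) - nu] into [nu^2] and leaves the potential term. *)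
transitivity (n * (n + 1) * s ^+ 2 * (c^-1 * (c^-1 * P)) - n * (c^-1 * P * c)).
  by ring.
by rewrite sh2 -/c; field; exact: coshR_neq0.
Qed.

Lemma bound_state_le nu x : (1 <= nu)%N -> `|bound_state nu x| <= 1 * sechR x.
Proof.
case: nu => // n _; rewrite normrX gtr0_norm ?sechR_gt0// mul1r exprS.
by rewrite ler_piMr ?exprn_ile1 ?sechR_le1 ?(ltW (sechR_gt0 _)).
Qed.

Lemma bound_state1_le nu x : (1 <= nu)%N ->
  `|bound_state1 nu x| <= nu%:R * sechR x.
Proof.
move=> nu1; rewrite normrN normrM ger0_norm// ler_wpM2l//.
rewrite exprS mulrA normrM -[leRHS]mul1r ler_pM//; first exact: sinhR_sechR_le1.
by have := bound_state_le x nu1; rewrite mul1r.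
Qed.

Lemma bound_state2_le nu x : (1 <= nu)%N ->
  `|bound_state2 nu x| <= ((nu ^ 2)%:R + (nu * nu.+1)%:R) * sechR x.
Proof.
move=> nu1; rewrite /bound_state2 -mulrDl normrM.
apply: ler_pM => //; last by have := bound_state_le x nu1; rewrite mul1r.
apply: le_trans (ler_normD _ _) _; rewrite ger0_norm// lerD2l.
rewrite /potential mulNr normrN normrM ger0_norm// ler_piMr//.
rewrite -exprVn normrX exprn_ile1// gtr0_norm ?sechR_gt0//; exact: sechR_le1.
Qed.

Lemma continuous_potential nu : continuous (@potential R nu).
Proof.
rewrite (_ : potential nu = (fun x => - (nu * nu.+1)%:R * (sechR x * sechR x))); last first.
  by apply/funext => x; rewrite /potential -exprVn expr2.
move=> x; apply: cvgM; first exact: cvg_cst.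
by apply: cvgM; exact: continuous_sechR.
Qed.

Lemma continuous_bound_state nu : continuous (bound_state nu).
Proof. exact: is_derive_continuous (is_derive_bound_state nu). Qed.

Lemma continuous_bound_state2 nu : continuous (bound_state2 nu).
Proof.
move=> x; apply: cvgD; apply: cvgM.
- exact: cvg_cst.
- exact: continuous_bound_state.
- exact: continuous_potential.
- exact: continuous_bound_state.
Qed.

Lemma schrodinger_bound_state nu : (1 <= nu)%N ->
  schrodinger (@potential R nu) (fun x => (bound_state nu x)%:C)
    (fun x => - (((nu ^ 2)%:R)%:C * (bound_state nu x)%:C)).
Proof.
move=> nu1.
have h0 : inL2 (fun x => (bound_state nu x)%:C).
  apply: inL2_sechR_dominated => [|x]; first exact: continuous_bound_state.
  exact: bound_state_le.
split => //; first by apply: inL2N; exact: inL2Z.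
exists (fun x => (bound_state1 nu x)%:C), (fun x => (bound_state2 nu x)%:C); split.
- apply: inL2_sechR_dominated => [|x]; last exact: bound_state1_le.
  exact: is_derive_continuous (is_derive_bound_state1 nu).
- apply: inL2_sechR_dominated => [|x]; last exact: bound_state2_le.
  exact: continuous_bound_state2.
- apply: weak_derivative_real; first exact: is_derive_bound_state.
  exact: is_derive_continuous (is_derive_bound_state1 nu).
- apply: weak_derivative_real; first exact: is_derive_bound_state1.
  exact: continuous_bound_state2.
- apply: aeW => x; rewrite /bound_state2 rmorphD !rmorphM/=; ring.
Qed.

End bound_state.

(** * Failure of the kernel estimates *)

Section heat_kernel_bounds.
Context {R : realType}.
Notation mu := (@lebesgue_measure R).

(** An interval of positive length does not fit in a null set. This turns almost everywhere
    identities into identities at a point of known location. *)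
Lemma ae_itv_ex (P : R -> Prop) (a b : R) : a < b ->
  {ae mu, forall x, P x} -> exists2 x, a <= x <= b & P x.
Proof.
move=> ab [N [mN N0 PN]]; apply: contrapT => h.
have abN : `[a, b] `<=` N.
  move=> x /=; rewrite in_itv/= => xab; apply: PN => Px.
  by apply: h; exists x.
have : (mu `[a, b] <= mu N)%E by apply: le_measure; rewrite ?inE.
rewrite N0 lebesgue_measure_itv/= lte_fin ab -EFinD lee_fin subr_le0.
by rewrite leNgt ab.
Qed.

Lemma bound_state_gt0 nu (x : R) : 0 < bound_state nu x.
Proof. by rewrite exprn_gt0// sechR_gt0. Qed.

Lemma bound_state_near0 nu (x : R) : 0 <= x <= 1 ->
  (expR 1)^-1 ^+ nu <= bound_state nu x.
Proof.
move=> /andP[x0 x1]; rewrite lerXn2r ?nnegrE ?(ltW (sechR_gt0 _)) ?invr_ge0 ?expR_ge0//.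
rewrite /sechR lef_pV2 ?posrE ?expR_gt0 ?coshR_gt0// ler_pdivrMr//.
have : expR x <= expR 1 by rewrite ler_expR.
have : expR (- x) <= expR 1 by rewrite ler_expR; lra.
by lra.
Qed.

Lemma bound_state_far nu (x : R) : 3 <= x <= 4 ->
  bound_state nu x <= (2 * (expR 3)^-1) ^+ nu.
Proof.
move=> /andP[x3 x4].
rewrite lerXn2r ?nnegrE ?(ltW (sechR_gt0 _)) ?mulr_ge0 ?invr_ge0 ?expR_ge0//.
rewrite -[leRHS](invf_div (expR 3) 2) /sechR lef_pV2 ?posrE ?coshR_gt0 ?divr_gt0 ?expR_gt0//.
rewrite /coshR ler_pM2r ?invr_gt0//.
have : expR 3 <= expR x by rewrite ler_expR.
by have := expR_ge0 (- x); lra.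
Qed.

(** The bound state is quantitatively non-constant: its values on [[3, 4]] lie below those on
    [[0, 1]] by a fixed gap. The inequality reduces to [2 < e^2]. *)
Lemma bound_state_gap nu : (1 <= nu)%N ->
  (2 * (expR 3)^-1 : R) ^+ nu < (expR 1)^-1 ^+ nu.
Proof.
move=> nu1; rewrite ltrXn2r ?mulr_ge0 ?invr_ge0 ?expR_ge0 -?lt0n//.
have e1 := expR_gt0 (1 : R); have e2 := expR_ge1Dx (2 : R).
have e3 : expR 3 = expR 1 * expR 2 :> R by rewrite -expRD; congr expR; ring.
rewrite e3 invfM mulrCA gtr_pMr ?invr_gt0// ltr_pdivrMr ?mul1r ?expR_gt0//.
by lra.
Qed.

(** At [t = max (T, 1, K / m)] one has [K / m <= t < 1 + L t <= expR (L * t)]. *)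
Lemma expR_linear_unbounded (m K L T : R) : 0 < m -> 1 <= L ->
  ~ (forall t, T <= t -> 1 <= t -> expR (L * t) * m <= K).
Proof.
move=> m0 L1 h; pose t := Num.max T (Num.max 1 (K / m)).
have Tt : T <= t by rewrite le_max lexx.
have t1 : 1 <= t by rewrite !le_max lexx orbT.
have tK : K / m <= t by rewrite !le_max lexx !orbT.
have := h t Tt t1; rewrite -ler_pdivlMr// => /le_trans/(_ tK).
by have := expR_ge1Dx (L * t); nra.
Qed.

(** * The heat kernel tested against the bound state *)

Definition bound_mass nu : R := \int[mu]_y bound_state nu y.

Lemma integrable_bound_state nu : (1 <= nu)%N ->
  mu.-integrable setT (EFin \o @bound_state R nu).
Proof.
move=> nu1; apply: integrable_sechR_dominated (fun x => bound_state_le x nu1).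
exact: continuous_bound_state.
Qed.

(** Applied below with [k] the real part of the kernel at one point, or the difference of its real
    parts at two points. *)
Lemma le_Rintegral_bound_state nu (k : R -> R) (K : R) : (1 <= nu)%N ->
  mu.-integrable setT (EFin \o (fun y => k y * bound_state nu y)) ->
  (forall y, `|k y| <= K) ->
  \int[mu]_y (k y * bound_state nu y) <= K * bound_mass nu.
Proof.
move=> nu1 ik kK; rewrite -RintegralZl//; last exact: integrable_bound_state.
apply: le_Rintegral => //.
  exact: (integrableZl measurableT K (integrable_bound_state nu1)).
move=> y _; rewrite ler_wpM2r ?(ltW (bound_state_gt0 _ _))//.
by rewrite (le_trans (ler_norm _)).
Qed.

(** The kernel representation of [S t psi] is equated with [e^(nu^2 t) psi]. As [psi] is real,
    taking real parts leaves only the real part of the kernel. *)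
Lemma heat_kernel_bound_state nu (p : R -> R -> R -> R[i]) : (1 <= nu)%N ->
  heat_kernel (potential nu) p -> forall t, 0 < t ->
  {ae mu, forall x,
    mu.-integrable setT (EFin \o (fun y => complex.Re (p t x y) * bound_state nu y)) /\
    expR ((nu ^ 2)%:R * t) * bound_state nu x =
    \int[mu]_y (complex.Re (p t x y) * bound_state nu y)}.
Proof.
move=> nu1 [S [hS hgen] hp] t t0.
pose psi x := (@bound_state R nu x)%:C.
have [L2psi _ _] := schrodinger_bound_state nu1 (R := R).
have gen : sg_generator S psi (fun x => ((nu ^ 2)%:R)%:C * psi x).
  exact/hgen/schrodinger_bound_state.
have orb := eigenvector_orbit hS (ler0n _ _) gen (ltW t0).
have [_ /(_ _ L2psi) ker] := hp t t0.
have ReE x : repart (fun y => p t x y * psi y) =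
    (fun y => complex.Re (p t x y) * bound_state nu y).
  by apply/funext => y; rewrite /repart complexReM /= mulr0 subr0.
apply: ae_imp (ae_and orb ker) => x [Sx [[ip _] px]]; rewrite ReE in ip.
split => //; have := congr1 (@complex.Re R) px; rewrite Sx.
by rewrite complexReM /= mul0r subr0 ReE.
Qed.

(** For [t >= 1] the power of [t] and the Gaussian are at most 1, so the kernel is bounded by [C].
    At a point of [[0, 1]] this keeps [e^(nu^2 t) psi] below [C] times the mass of [psi], for all
    large [t]. *)
Lemma not_kernel_bound nu (p : R -> R -> R -> R[i]) (C c T : R) : (1 <= nu)%N ->
  heat_kernel (potential nu) p -> 0 < C -> 0 < c -> 0 < T ->
  ~ kernel_bound p C c T.
Proof.
move=> nu1 hp C0 c0 T0 hb.
have m0 : 0 < (expR 1)^-1 ^+ nu :> R by rewrite exprn_gt0// invr_gt0 expR_gt0.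
have L1 : 1 <= (nu ^ 2)%:R :> R by rewrite ler1n expn_gt0 nu1.
apply: (@expR_linear_unbounded _ (C * bound_mass nu) _ T m0 L1) => t Tt t1.
have t0 : 0 < t by exact: lt_le_trans t1.
have [x x01 [ik xE]] := ae_itv_ex ltr01 (heat_kernel_bound_state nu1 hp t0).
apply: (@le_trans _ _ (expR ((nu ^ 2)%:R * t) * bound_state nu x)).
  by rewrite ler_wpM2l ?expR_ge0// bound_state_near0.
rewrite xE; apply: le_Rintegral_bound_state => // y.
apply: le_trans (ler_Re_cabs _) _; apply: le_trans (hb _ _ _ Tt) _.
rewrite -mulrA ler_piMr ?(ltW C0)// mulr_ile1 ?powR_ge0 ?expR_ge0//.
  have half0 : 0 <= 2^-1 :> R by rewrite invr_ge0.
  have := ge0_ler_powR half0 (ler01 : 1 \is Num.nneg) (ltW t0 : t \is Num.nneg) t1.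
  by rewrite powRN invf_le1 ?powR_gt0// powR1.
rewrite -[leRHS]expR0 ler_expR mulNr mulNr oppr_le0.
by rewrite divr_ge0 ?(ltW t0)// mulr_ge0 ?(ltW c0)// sqr_ge0.
Qed.

(** The same scheme is applied to the difference of values at [x] in [[0, 1]] and [z] in [[3, 4]]:
    the derivative bound controls the difference of kernels, while the gap of the bound state grows
    like [e^(nu^2 t)]. *)
Lemma not_kernel_dx_bound nu (p : R -> R -> R -> R[i]) (C c T : R) : (1 <= nu)%N ->
  heat_kernel (potential nu) p -> 0 < C -> 0 < c -> 0 < T ->
  ~ kernel_dx_bound p C c T.
Proof.
move=> nu1 hp C0 c0 T0 hb.
pose m : R := (expR 1)^-1 ^+ nu - (2 * (expR 3)^-1) ^+ nu.
have m0 : 0 < m by rewrite subr_gt0; exact: bound_state_gap.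
have L1 : 1 <= (nu ^ 2)%:R :> R by rewrite ler1n expn_gt0 nu1.
apply: (@expR_linear_unbounded _ (C * 4 * bound_mass nu) _ T m0 L1) => t Tt t1.
have t0 : 0 < t by exact: lt_le_trans t1.
have hae := heat_kernel_bound_state nu1 hp t0.
have [x x01 [ix xE]] := ae_itv_ex ltr01 hae.
have [z z34 [iz zE]] := ae_itv_ex (ltr_nat R 3 4) hae.
apply: (@le_trans _ _ (expR ((nu ^ 2)%:R * t) * (bound_state nu x - bound_state nu z))).
  by rewrite ler_wpM2l ?expR_ge0// lerB ?bound_state_near0 ?bound_state_far.
rewrite mulrBr xE zE -RintegralB//.
under eq_Rintegral do rewrite -mulrBl.
apply: le_Rintegral_bound_state => //.
  have := integrableB measurableT ix iz.
  by under eq_fun do rewrite /= -EFinB -mulrBl.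
move=> y; pose f u := complex.Re (p t u y).
have df (u : R) : is_derive u 1 f (derive1 f u).
  by rewrite derive1E; apply: derivableP; have [[]] := hb t u y Tt.
have dfC (u : R) : `|derive1 f u| <= C.
  have [_ h] := hb t u y Tt.
  apply: le_trans (le_trans (ler_Re_cabs (cderive (fun x' => p t x' y) u)) h) _.
  rewrite -mulrA ler_piMr ?(ltW C0)// mulr_ile1 ?invr_ge0 ?expR_ge0 ?(ltW t0)//.
    by rewrite invf_le1.
  rewrite -[leRHS]expR0 ler_expR mulNr mulNr oppr_le0.
  by rewrite divr_ge0 ?(ltW t0)// mulr_ge0 ?(ltW c0)// sqr_ge0.
have xz : x < z by move: x01 z34 => /andP[_ x1] /andP[z3 _]; lra.
(* The mean value theorem is used on the real part alone; with [|f'| <= C] and [z - x <= 4] it gives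
   the constant [C * 4]. *)
have [|v _ vE] := @MVT _ f (derive1 f) x z xz (fun u _ => df u).
  by apply: continuous_subspaceT; exact: is_derive_continuous df.
rewrite distrC [X in `|X|]vE normrM ler_pM//.
by move: x01 z34 => /andP[x0 _] /andP[_ z4]; rewrite gtr0_norm; lra.
Qed.

End heat_kernel_bounds.

Theorem mainTheorem2 (R : realType) (nu : nat) (nu_ge1 : (1 <= nu)%N)
    (p : R -> R -> R -> R[i]) (hp : heat_kernel (potential nu) p) :
  (~ exists C c T : R, [/\ 0 < C, 0 < c, 0 < T & kernel_bound p C c T]) /\
  (~ exists C c T : R, [/\ 0 < C, 0 < c, 0 < T & kernel_dx_bound p C c T]).
Proof.
split=> -[C [c [T [C0 c0 T0]]]].
  exact: not_kernel_bound nu_ge1 hp C0 c0 T0.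
exact: not_kernel_dx_bound nu_ge1 hp C0 c0 T0.
Qed.
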